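(* Let $k,g,\omega>0$, $m\in\mathbb{R}$, $c:=\frac{g-km^2}{2\omega}$, and let $(a,b)\in\Sigma:=\mathbb{R}\times(-\infty,0)$ be the parameter of a particle whose path for $t\ge0$ is $$X(t,a,b)=a+(c-m)t-\frac{e^{kb}}{k}\sin(k(a-mt)),\qquad Z(t,a,b)=b+\frac{e^{kb}}{k}\cos(k(a-mt)).$$ Define $$m_1:=\frac{-\omega-\sqrt{\omega^2+gk}}{k}<m_2:=\frac{-\omega+\sqrt{\omega^2+gk}}{k}.$$ Then: (a) If $m=m_1$ (resp. $m=m_2$), then the particle moves counterclockwise (resp. clockwise) on a circle. (b) If $m\in(-\infty,m_1)\cup(0,m_2)$, then the particle moves on a trochoid. Letting $$b_*:=\frac1k\ln\left(\frac{g-km^2-2\omega m}{2\omega m}\right),$$ the trochoid is of one of the following types: a prolate cycloid if $b>b_*$; a cycloid if $b=b_*$; a curtate cycloid if $b<b_*$. (c) If $m\in(m_1,0)\cup(m_2,\infty)$, then the particle moves on a reflected trochoid. Letting $$b^*:=\frac1k\ln\left(\frac{g-km^2-2\omega m}{-2\omega m}\right),$$ the trochoid is of one of the following types: a prolate cycloid if $b>b^*$; a cycloid if $b=b^*$; a curtate cycloid if $b<b^*$.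
   Context: The orientation is that of the $(X,Z)$-plane with the $X$-axis pointing to the right and the $Z$-axis upward. A trochoid is a curve traced by a point at distance $\delta>0$ from the centre of a circle of radius $r>0$ rolling (from below supported) on a fixed horizontal line, i.e. a planar curve of the form $$\{(x_0+r\tau+\delta\sin\tau,\ z_0+\delta\cos\tau):\tau\in\mathbb{R}\},\qquad x_0,z_0\in\mathbb{R}.$$ It is called a curtate cycloid if $\delta<r$, a cycloid (with downward cusps) if $\delta=r$, and a prolate cycloid (with self-intersections) if $\delta>r$. A reflected trochoid is the reflection of a trochoid with respect to a horizontal line; its type is that of the trochoid being reflected. ''The particle moves on a curve'' means that its path, $t\ge0$, is contained in that curve. *)

(* Defs.v *)
From mathcomp Require Import all_boot all_order all_algebra.
From mathcomp Require Import all_classical all_reals all_analysis.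
Set Implicit Arguments.
Unset Strict Implicit.
Unset Printing Implicit Defensive.
Import Order.TTheory GRing.Theory Num.Theory.
Import numFieldNormedType.Exports.
Local Open Scope classical_set_scope.
Local Open Scope ring_scope.

(* Points of the plane are pairs (X, Z) : R * R, with the X-axis pointing to
   the right and the Z-axis upward, so that the polar angle measured from the
   positive X-axis towards the positive Z-axis increases counterclockwise. *)

Definition moves_on (R : realType) (gamma : R -> R * R) (C : set (R * R)) :=
  gamma @` `[0, +oo[ `<=` C.

Definition circle (R : realType) (q : R * R) (rho : R) : set (R * R) :=
  [set p | (p.1 - q.1) ^+ 2 + (p.2 - q.2) ^+ 2 = rho ^+ 2].

(* Continuity makes the angle unique up to a constant multiple of 2 pi. *)
Definition polar_angle (R : realType) (q : R * R) (gamma : R -> R * R)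
    (phi : R -> R) :=
  {within `[0, +oo[, continuous phi} /\
  forall t, 0 <= t -> exists2 s, 0 < s &
    gamma t = (q.1 + s * cos (phi t), q.2 + s * sin (phi t)).

Definition counterclockwise (R : realType) (q : R * R) (gamma : R -> R * R) :=
  exists2 phi : R -> R, polar_angle q gamma phi &
    {in `[0, +oo[ &, {homo phi : s t / s < t}}.

Definition clockwise (R : realType) (q : R * R) (gamma : R -> R * R) :=
  exists2 phi : R -> R, polar_angle q gamma phi &
    {in `[0, +oo[ &, {homo phi : s t / s < t >-> t < s}}.

Definition trochoid (R : realType) (x0 z0 r delta : R) : set (R * R) :=
  range (fun tau => (x0 + r * tau + delta * sin tau, z0 + delta * cos tau)).

Definition is_trochoid (R : realType) (C : set (R * R)) :=
  exists x0 z0 r delta : R,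
    [/\ 0 < r, 0 < delta & C = trochoid x0 z0 r delta].

Definition curtate_cycloid (R : realType) (C : set (R * R)) :=
  exists x0 z0 r delta : R,
    [/\ 0 < r, 0 < delta, delta < r & C = trochoid x0 z0 r delta].

Definition cycloid (R : realType) (C : set (R * R)) :=
  exists x0 z0 r delta : R,
    [/\ 0 < r, 0 < delta, delta = r & C = trochoid x0 z0 r delta].

Definition prolate_cycloid (R : realType) (C : set (R * R)) :=
  exists x0 z0 r delta : R,
    [/\ 0 < r, 0 < delta, r < delta & C = trochoid x0 z0 r delta].

(* Reflection with respect to the horizontal line Z = h. *)
Definition reflect_horizontal (R : realType) (h : R) (p : R * R) : R * R :=
  (p.1, 2 * h - p.2).

Definition drift (R : realType) (k g omega m : R) : R :=
  (g - k * m ^+ 2) / (2 * omega).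

Definition particle_path (R : realType) (k g omega m a b : R) (t : R) : R * R :=
  (a + (drift k g omega m - m) * t
     - expR (k * b) / k * sin (k * (a - m * t)),
   b + expR (k * b) / k * cos (k * (a - m * t))).

(* Main.v *)
(* With theta = k (a - m t) the horizontal drift V = c - m turns into an affine
   function of theta of slope - V / (k m), while the oscillating part is a
   rotation of radius e^(kb) / k. Since 2 omega V = - k (m - m1) (m - m2), the
   drift vanishes exactly for m = m1, m2, and otherwise the sign of V / m decides
   whether theta is the rolling parameter tau reversed (a trochoid) or shifted by
   pi (a reflected trochoid). The type is read off by comparing the arm
   e^(kb) / k with the rolling radius |V / (k m)|. *)
Require Import Defs.
From mathcomp Require Import all_boot all_order all_algebra.
From mathcomp Require Import all_classical all_reals all_analysis.
From mathcomp Require Import ring lra.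
Import Order.TTheory GRing.Theory Num.Theory.
Import numFieldNormedType.Exports.
Local Open Scope classical_set_scope.
Local Open Scope ring_scope.

(** The left side is [2 * omega] times the drift [V], so the factors locate the zeros of [V] and
    decide its sign. *)
Lemma quadratic_factor (R : rcfType) (k g omega m : R) :
  0 < k -> 0 < g ->
  let m1 := (- omega - Num.sqrt (omega ^+ 2 + g * k)) / k in
  let m2 := (- omega + Num.sqrt (omega ^+ 2 + g * k)) / k in
  g - k * m ^+ 2 - 2 * omega * m = k * (m - m1) * (m2 - m).
Proof.
move=> hk hg /=.
have sE : Num.sqrt (omega ^+ 2 + g * k) ^+ 2 = omega ^+ 2 + g * k.
  by rewrite sqr_sqrtr // addr_ge0 ?sqr_ge0 // mulr_ge0 ?ltW.
move: (Num.sqrt _) sE => s sE.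
(* Trading [g] for the root [s] leaves an identity of rational functions in [k], [omega], [m] and
   [s]. *)
have -> : g = (s ^+ 2 - omega ^+ 2) / k.
  by rewrite sE; field; rewrite gt_eqF.
by field; rewrite gt_eqF.
Qed.

(** As [g * k > 0], the square root exceeds [omega]. The opposite signs yield the opposite senses of
    rotation in (a). *)
Lemma roots_sign (R : rcfType) (k g omega : R) :
  0 < k -> 0 < g -> 0 < omega ->
  (- omega - Num.sqrt (omega ^+ 2 + g * k)) / k < 0 /\
  0 < (- omega + Num.sqrt (omega ^+ 2 + g * k)) / k.
Proof.
move=> hk hg ho.
have s_gt : omega < Num.sqrt (omega ^+ 2 + g * k).
  by rewrite -{1}(gtr0_norm ho) -sqrtr_sqr ltr_sqrt ?ltrDl
    ?addr_gt0 ?exprn_gt0 ?mulr_gt0.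
by rewrite pmulr_llt0 ?invr_gt0 // pmulr_lgt0 ?invr_gt0 //; split; lra.
Qed.

Lemma drift_subE (R : realType) (k g omega m : R) : omega != 0 ->
  drift k g omega m - m = (g - k * m ^+ 2 - 2 * omega * m) / (2 * omega).
Proof. by move=> ho; rewrite /drift; field. Qed.

Section Driftless.
Context {R : realType} (k g omega m a b : R).
Hypotheses (hk : 0 < k) (hV : drift k g omega m - m = 0).
Let gamma := particle_path k g omega m a b.
Let rho := expR (k * b) / k.

Let rho_gt0 : 0 < rho. Proof. by rewrite divr_gt0 ?expR_gt0. Qed.

Lemma driftless_circle : moves_on gamma (circle (a, b) rho).
Proof.
move=> _ [t _ <-]; rewrite /circle /gamma /particle_path /= hV -/rho.
by rewrite -[rho ^+ 2 in RHS]mulr1 -(cos2Dsin2 (k * (a - m * t))); ring.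
Qed.

(** The quarter turn rewrites the direction [(- sin theta, cos theta)] as [(cos phi, sin phi)]. The
    slope of [phi] is [- k * m], so the sign of [m] fixes the orientation. *)
Let phi (t : R) := k * (a - m * t) + pi / 2.

Lemma driftless_polar_angle : polar_angle (a, b) gamma phi.
Proof.
split.
  apply: continuous_subspaceT => t; apply: cvgD; last exact: cvg_cst.
  apply: cvgM; first exact: cvg_cst.
  apply: cvgB; first exact: cvg_cst.
  by apply: cvgM; [exact: cvg_cst | exact: cvg_id].
move=> t _; exists rho => //.
by rewrite /gamma /particle_path /phi hV cosDpihalf sinDpihalf -/rho /=;
  congr pair; ring.
Qed.

Lemma driftless_counterclockwise : m < 0 -> counterclockwise (a, b) gamma.
Proof.
move=> hm; exists phi; first exact: driftless_polar_angle.
by move=> s t _ _ st; rewrite ltrD2r ltr_pM2l // ltrD2l ltrN2 ltr_nM2l.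
Qed.

Lemma driftless_clockwise : 0 < m -> clockwise (a, b) gamma.
Proof.
move=> hm; exists phi; first exact: driftless_polar_angle.
by move=> s t _ _ st; rewrite ltrD2r ltr_pM2l // ltrD2l ltrN2 ltr_pM2l.
Qed.

End Driftless.

(** Comparing the arm with the radius means comparing [expR (k * b)] with [x], hence [b] with
    [k^-1 * ln x]. Both thresholds of the theorem have this form. *)
Lemma trochoid_types (R : realType) (k x b x0 z0 : R) :
  0 < k -> 0 < x ->
  let C := trochoid x0 z0 (x / k) (expR (k * b) / k) in
  [/\ is_trochoid C,
      k^-1 * ln x < b -> prolate_cycloid C,
      b = k^-1 * ln x -> cycloid C &
      b < k^-1 * ln x -> curtate_cycloid C].
Proof.
move=> hk hx C.
have r0 : 0 < x / k by rewrite divr_gt0.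
have d0 : 0 < expR (k * b) / k by rewrite divr_gt0 ?expR_gt0.
split; first by exists x0, z0, (x / k), (expR (k * b) / k).
- move=> h; exists x0, z0, (x / k), (expR (k * b) / k); split => //.
  rewrite ltr_pM2r ?invr_gt0 // -[ltLHS]lnK ?posrE // ltr_expR.
  by rewrite -ltr_pdivrMl.
- move=> h; exists x0, z0, (x / k), (expR (k * b) / k); split => //.
  by rewrite h mulVKf ?gt_eqF // lnK ?posrE.
- move=> h; exists x0, z0, (x / k), (expR (k * b) / k); split => //.
  rewrite ltr_pM2r ?invr_gt0 // -[ltRHS]lnK ?posrE // ltr_expR.
  by rewrite -ltr_pdivlMl.
Qed.

(** Take [tau = - theta], so that [t = a / m + tau / (k * m)]; the sine changes sign and the cosine
    does not. *)
Lemma path_trochoid (R : realType) (k g omega m a b : R) :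
  k != 0 -> m != 0 -> let V := drift k g omega m - m in
  moves_on (particle_path k g omega m a b)
    (trochoid (a + V * a / m) b (V / m / k) (expR (k * b) / k)).
Proof.
move=> hk hm V _ [t _ <-]; exists (- (k * (a - m * t))) => //.
rewrite /particle_path -/V sinN cosN; congr pair.
by field; rewrite hk hm.
Qed.

(** Take [tau = theta + pi]: sine and cosine both change sign, and the reflection in the line
    [Z = b] restores the cosine. The shift by [pi] accounts for the extra term in [x0]. *)
Lemma path_reflected_trochoid (R : realType) (k g omega m a b : R) :
  k != 0 -> m != 0 -> let V := drift k g omega m - m in
  moves_on (particle_path k g omega m a b)
    (reflect_horizontal b @`
      trochoid (a + V * a / m + V / m / k * pi) b (- (V / m) / k)
        (expR (k * b) / k)).
Proof.
move=> hk hm V _ [t _ <-].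
eexists; first by exists (k * (a - m * t) + pi).
rewrite /reflect_horizontal /particle_path -/V sinDpi cosDpi /=.
congr pair; last by ring.
by field; rewrite hk hm.
Qed.

Theorem proposition4p4 (R : realType) (k g omega m a b : R)
    (hk : 0 < k) (hg : 0 < g) (homega : 0 < omega) (hb : b < 0) :
  let gamma := particle_path k g omega m a b in
  let m1 := (- omega - Num.sqrt (omega ^+ 2 + g * k)) / k in
  let m2 := (- omega + Num.sqrt (omega ^+ 2 + g * k)) / k in
  let b_low := k^-1 *
    ln ((g - k * m ^+ 2 - 2 * omega * m) / (2 * omega * m)) in
  let b_up := k^-1 *
    ln ((g - k * m ^+ 2 - 2 * omega * m) / (- 2 * omega * m)) in
  m1 < m2 /\
  (* (a) *)
  (m = m1 -> exists (q : R * R) (rho : R),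
     [/\ 0 < rho, moves_on gamma (circle q rho) & counterclockwise q gamma]) /\
  (m = m2 -> exists (q : R * R) (rho : R),
     [/\ 0 < rho, moves_on gamma (circle q rho) & clockwise q gamma]) /\
  (* (b) *)
  (m < m1 \/ 0 < m < m2 -> exists C : set (R * R),
     [/\ is_trochoid C,
         moves_on gamma C,
         b_low < b -> prolate_cycloid C,
         b = b_low -> cycloid C &
         b < b_low -> curtate_cycloid C]) /\
  (* (c) *)
  (m1 < m < 0 \/ m2 < m -> exists (C : set (R * R)) (h : R),
     [/\ is_trochoid C,
         moves_on gamma (reflect_horizontal h @` C),
         b_up < b -> prolate_cycloid C,
         b = b_up -> cycloid C &
         b < b_up -> curtate_cycloid C]).
Proof.
move=> gamma m1 m2 b_low b_up.
have k0 : k != 0 by rewrite gt_eqF.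
have o0 : omega != 0 by rewrite gt_eqF.
have [m1_lt0 m2_gt0] : m1 < 0 /\ 0 < m2 by exact: roots_sign.
have DE : g - k * m ^+ 2 - 2 * omega * m = k * (m - m1) * (m2 - m).
  exact: quadratic_factor.
have VE := drift_subE R k g omega m o0.
have rho0 : 0 < expR (k * b) / k by rewrite divr_gt0 ?expR_gt0.
split; first exact: lt_trans m2_gt0.
split.
  move=> mE; have V0 : drift k g omega m - m = 0.
    by rewrite VE DE mE subrr mulr0 !mul0r.
  exists (a, b), (expR (k * b) / k); split => //; first exact: driftless_circle.
  by apply: driftless_counterclockwise; rewrite // mE.
split.
  move=> mE; have V0 : drift k g omega m - m = 0.
    by rewrite VE DE mE subrr mulr0 mul0r.
  exists (a, b), (expR (k * b) / k); split => //; first exact: driftless_circle.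
  by apply: driftless_clockwise; rewrite // mE.
split.
  move=> hm.
  have m0 : m != 0 by case: hm => [?|/andP[? ?]]; lra.
  (* This quotient is [V / m]. For [m < m1] exactly [m - m1] and [m] are negative; for [0 < m < m2]
     no factor is. *)
  have x_gt0 : 0 < (g - k * m ^+ 2 - 2 * omega * m) / (2 * omega * m).
    rewrite DE -!mulrA pmulr_rgt0 //.
    case: hm => [hm|/andP[m_gt0 m_lt]].
      rewrite nmulr_rgt0 ?subr_lt0 // pmulr_rlt0 ?subr_gt0; last lra.
      by rewrite invr_lt0 pmulr_rlt0 // pmulr_rlt0 //; lra.
    by rewrite !mulr_gt0 ?invr_gt0 ?mulr_gt0 ?subr_gt0 //; lra.
  have [C1 C2 C3 C4] := trochoid_types R k _ b
    (a + (drift k g omega m - m) * a / m) b hk x_gt0.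
  eexists; split; [exact: C1 | | exact: C2 | exact: C3 | exact: C4].
  have /= := path_trochoid R k g omega m a b k0 m0.
  suff -> : (drift k g omega m - m) / m
    = (g - k * m ^+ 2 - 2 * omega * m) / (2 * omega * m) by [].
  by rewrite VE; field; rewrite o0 m0.
move=> hm.
have m0 : m != 0 by case: hm => [/andP[? ?]|?]; lra.
(* Now the quotient is [- V / m]. For [m2 < m] exactly [m2 - m] and the denominator are negative;
   for [m1 < m < 0] no factor is. *)
have x_gt0 : 0 < (g - k * m ^+ 2 - 2 * omega * m) / (- 2 * omega * m).
  rewrite DE -!mulrA pmulr_rgt0 //.
  case: hm => [/andP[m_gt m_lt0]|hm].
    by rewrite !mulr_gt0 ?invr_gt0 ?subr_gt0 ?mulNr ?oppr_gt0
      ?pmulr_rlt0 //; lra.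
  rewrite pmulr_rgt0 ?subr_gt0; last lra.
  rewrite nmulr_rgt0 ?subr_lt0 // invr_lt0 mulNr oppr_lt0.
  by rewrite !mulr_gt0 //; lra.
have [C1 C2 C3 C4] := trochoid_types R k _ b
  (a + (drift k g omega m - m) * a / m + (drift k g omega m - m) / m / k * pi)
  b hk x_gt0.
(* The mirror is the line of centres [Z = b], which the reflection fixes. *)
eexists; exists b; split; [exact: C1 | | exact: C2 | exact: C3 | exact: C4].
have /= := path_reflected_trochoid R k g omega m a b k0 m0.
suff -> : - ((drift k g omega m - m) / m)
  = (g - k * m ^+ 2 - 2 * omega * m) / (- 2 * omega * m) by [].
by rewrite VE; field; rewrite o0 m0.
Qed.
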